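(* Let $X$ be a topological space. The following statements are equivalent: (1) $X$ is $e^*\theta$-normal; (2) for every pair of open sets $U$ and $V$ with $U\cup V=X$, there exist $ge^*\theta$-closed sets $A$ and $B$ such that $A\subseteq U$, $B\subseteq V$ and $A\cup B=X$; (3) for each closed set $F$ and every open set $G$ containing $F$, there exists a $ge^*\theta$-open set $U$ of $X$ such that $F\subseteq U\subseteq e^*\text{-}cl_\theta(U)\subseteq G$; (4) for each pair of disjoint closed sets $F_1$ and $F_2$ of $X$, there exist disjoint $ge^*\theta$-open sets $U_1$ and $U_2$ such that $F_1\subseteq U_1$ and $F_2\subseteq U_2$.
   Context: For a subset $A$ of a topological space $X$, $cl(A)$ and $int(A)$ denote closure and interior. The $\delta$-closure $cl_\delta(A)$ is the set of points $x\in X$ such that $int(cl(U))\cap A\neq\emptyset$ for every open $U$ containing $x$. $A$ is $e^*$-open if $A\subseteq cl(int(cl_\delta(A)))$; complements of $e^*$-open sets are $e^*$-closed; $e^*\text{-}cl(A)$ is the intersection of all $e^*$-closed sets containing $A$. The $e^*$-$\theta$-closure $e^*\text{-}cl_\theta(A)$ is the set of points $x\in X$ such that $e^*\text{-}cl(U)\cap A\neq\emptyset$ for every $e^*$-open set $U$ containing $x$. $A$ is $e^*$-$\theta$-closed if $A=e^*\text{-}cl_\theta(A)$; complements of $e^*$-$\theta$-closed sets are called $e^*$-$\theta$-open. $A$ is $ge^*\theta$-closed (generalized $e^*\theta$-closed) if $e^*\text{-}cl_\theta(A)\subseteq U$ whenever $A\subseteq U$ and $U$ is open in $X$; $A$ is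 $ge^*\theta$-open if $X\setminus A$ is $ge^*\theta$-closed. $X$ is $e^*\theta$-normal if for any pair of disjoint closed sets $F_1$ and $F_2$ of $X$ there exist disjoint $e^*$-$\theta$-open sets $U_1$ and $U_2$ with $F_1\subseteq U_1$ and $F_2\subseteq U_2$. *)

(* Defs.v *)
From mathcomp Require Import all_boot all_order.
From mathcomp Require Import boolp classical_sets topology.

Set Implicit Arguments.
Unset Strict Implicit.
Unset Printing Implicit Defensive.

Local Open Scope classical_set_scope.

Definition delta_closure (X : topologicalType) (A : set X) : set X :=
  [set x | forall U : set X, open U -> U x ->
     interior (closure U) `&` A !=set0].

Definition estar_open (X : topologicalType) (A : set X) : Prop :=
  A `<=` closure (interior (delta_closure A)).

Definition estar_closed (X : topologicalType) (A : set X) : Prop :=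
  estar_open (~` A).

Definition estar_closure (X : topologicalType) (A : set X) : set X :=
  \bigcap_(C in [set C : set X | estar_closed C /\ A `<=` C]) C.

Definition estar_theta_closure (X : topologicalType) (A : set X) : set X :=
  [set x | forall U : set X, estar_open U -> U x ->
     estar_closure U `&` A !=set0].

Definition estar_theta_closed (X : topologicalType) (A : set X) : Prop :=
  A = estar_theta_closure A.

Definition estar_theta_open (X : topologicalType) (A : set X) : Prop :=
  estar_theta_closed (~` A).

Definition gestar_theta_closed (X : topologicalType) (A : set X) : Prop :=
  forall U : set X, open U -> A `<=` U -> estar_theta_closure A `<=` U.

Definition gestar_theta_open (X : topologicalType) (A : set X) : Prop :=
  gestar_theta_closed (~` A).

Definition estar_theta_normal (X : topologicalType) : Prop :=
  forall F1 F2 : set X, closed F1 -> closed F2 -> F1 `&` F2 = set0 ->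
  exists U1 U2 : set X,
    [/\ estar_theta_open U1, estar_theta_open U2, U1 `&` U2 = set0,
        F1 `<=` U1 & F2 `<=` U2].

(* Main.v *)
(** The only topological input is that the e*-theta-closure is idempotent. This
    holds because the e*-closure of an e*-open set is again e*-open: up to
    points of U itself, the e*-closure of U is the open set
    X \ cl(int(cl_delta(X \ U))). Granting it, e*-theta-closures are
    e*-theta-closed, so any generalized e*-theta-open set U can be shrunk to the
    e*-theta-open set X \ cl_theta(X \ U) while keeping the closed subsets of U. *)

Require Import Defs.
From mathcomp Require Import all_boot all_order.
From mathcomp Require Import boolp classical_sets topology.

Set Implicit Arguments.
Unset Strict Implicit.
Unset Printing Implicit Defensive.

Local Open Scope classical_set_scope.

Section EstarTheta.
Variable X : topologicalType.
Implicit Types A B U : set X.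

Lemma delta_closureS A B : A `<=` B -> delta_closure A `<=` delta_closure B.
Proof.
move=> AB x Ax U oU Ux; have [y [Uy Ay]] := Ax U oU Ux.
by exists y; split=> //; exact: AB.
Qed.

Lemma open_sub_interior_closure U : open U -> U `<=` interior (closure U).
Proof. by move=> oU; rewrite -open_subsetE//; exact: subset_closure. Qed.

Lemma subset_delta_closure A : A `<=` delta_closure A.
Proof.
by move=> x Ax U oU Ux; exists x; split=> //; exact: open_sub_interior_closure.
Qed.

Lemma subset_estar_closure A : A `<=` estar_closure A.
Proof. by move=> x Ax C [_]; exact. Qed.

Lemma estar_closure_sub A C :
  estar_closed C -> A `<=` C -> estar_closure A `<=` C.
Proof. by move=> cC AC x; apply. Qed.

Lemma estar_closure_idem A :
  estar_closure (estar_closure A) `<=` estar_closure A.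
Proof.
by move=> x clx C [cC AC]; apply: clx; split=> //; exact: estar_closure_sub.
Qed.

(** With [W] the interior of the delta-closure of [A], testing a point of [W] on [V] intersected
    with [W] instead of [V] yields a point of [A] that already lies in [closure W]. So the cut keeps
    all of [W] in the delta-closure. *)
Lemma estar_open_cap_closure A :
  estar_open (A `&` closure (interior (delta_closure A))).
Proof.
set W := interior (delta_closure A).
have oW : open W by exact: open_interior.
suff WD : W `<=` interior (delta_closure (A `&` closure W)).
  by move=> x [_]; exact: closureS.
rewrite -open_subsetE// => y Wy V oV Vy.
have [z [VWz Az]] := interior_subset Wy _ (openI oV oW) (conj Vy Wy).
exists z; split.
  by apply: interiorS VWz; apply: closureS; exact: subIsetl.
split=> //; apply: (interior_subset (A := closure W)).
by apply: interiorS VWz; apply: closureS; exact: subIsetr.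
Qed.

Lemma estar_open_estar_closure U : estar_open U -> estar_open (estar_closure U).
Proof.
move=> eoU; set O := ~` closure (interior (delta_closure (~` U))).
have oO : open O by apply: closed_openC; exact: closed_closure.
have clE : estar_closure U `<=` U `|` O.
  apply: estar_closure_sub; last exact: subsetUl.
  by rewrite /estar_closed setCU setCK; exact: estar_open_cap_closure.
have OC : O `<=` estar_closure U.
  move=> x Ox C [cC UC]; apply: contrapT => nCx; apply: Ox.
  apply: closureS (cC x nCx).
  by apply: interiorS; apply: delta_closureS; exact: subsetC.
move=> x /clE[Ux|Ox].
  apply: closureS (eoU x Ux); apply: interiorS.
  by apply: delta_closureS; exact: subset_estar_closure.
apply: subset_closure; suff: O `<=` interior (delta_closure (estar_closure U)).
  exact.
by rewrite -open_subsetE// => y /OC; exact: subset_delta_closure.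
Qed.

Lemma subset_estar_theta_closure A : A `<=` estar_theta_closure A.
Proof.
by move=> x Ax U _ Ux; exists x; split=> //; exact: subset_estar_closure.
Qed.

Lemma estar_theta_closureS A B :
  A `<=` B -> estar_theta_closure A `<=` estar_theta_closure B.
Proof.
move=> AB x Ax U oU Ux; have [y [Uy Ay]] := Ax U oU Ux.
by exists y; split=> //; exact: AB.
Qed.

Lemma estar_theta_closed_closure A : estar_theta_closed (estar_theta_closure A).
Proof.
apply/seteqP; split; first exact: subset_estar_theta_closure.
move=> x clx U oU Ux; have [y [Uy Ay]] := clx U oU Ux.
(* The e*-closure of [U] is itself an admissible test set at [y]. *)
have [z [Uz Az]] := Ay _ (estar_open_estar_closure oU) Uy.
by exists z; split=> //; exact: estar_closure_idem.
Qed.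

Lemma estar_theta_closed_gestar A : estar_theta_closed A -> gestar_theta_closed A.
Proof. by move=> cA U _; rewrite -cA. Qed.

End EstarTheta.

Theorem theorem6 (X : topologicalType) :
  [<-> estar_theta_normal X;
       forall U V : set X, open U -> open V -> U `|` V = setT ->
         exists A B : set X,
           [/\ gestar_theta_closed A, gestar_theta_closed B,
               A `<=` U, B `<=` V & A `|` B = setT];
       forall F G : set X, closed F -> open G -> F `<=` G ->
         exists U : set X,
           [/\ gestar_theta_open U, F `<=` U,
               U `<=` estar_theta_closure U & estar_theta_closure U `<=` G];
       forall F1 F2 : set X, closed F1 -> closed F2 -> F1 `&` F2 = set0 ->
         exists U1 U2 : set X,
           [/\ gestar_theta_open U1, gestar_theta_open U2, U1 `&` U2 = set0,
               F1 `<=` U1 & F2 `<=` U2]].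
Proof.
tfae.
- move=> normX U V oU oV UV.
  have [] := normX (~` U) (~` V); [exact: open_closedC..| |].
    by rewrite -setCU UV setCT.
  move=> U1 [U2 [oU1 oU2 U12 UU1 VU2]]; exists (~` U1), (~` U2).
  split; [exact: estar_theta_closed_gestar..| | |].
  + exact/subsetCPl.
  + exact/subsetCPl.
  + by rewrite -setCI U12 setC0.
- move=> cover F G cF oG FG.
  have [] := cover (~` F) G; [exact: closed_openC|exact: oG| |].
    by apply/seteqP; split=> // x _; have [/FG|] := pselect (F x); [right|left].
  move=> A [B [gA gB AF BG AB]]; exists (~` A).
  split.
  + by rewrite /gestar_theta_open setCK.
  + by apply/subsetCPr.
  + exact: subset_estar_theta_closure.
  (* Since [A] and [B] cover the space, the complement of [A] lies in [B], whose theta-closure stays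
     in [G]. *)
  + apply: subset_trans (gB G oG BG); apply: estar_theta_closureS => x nAx.
    by have [] : (A `|` B) x by rewrite AB.
- move=> insert F1 F2 cF1 cF2 F12.
  have [] := insert F1 (~` F2) cF1 (closed_openC cF2).
    exact/disjoints_subset.
  (* The theta-closure of [U] misses [F2], so its complement serves as the second separating set. *)
  move=> U [oU F1U UclU clUF2]; exists U, (~` estar_theta_closure U); split=> //.
  + rewrite /gestar_theta_open setCK.
    by apply: estar_theta_closed_gestar; exact: estar_theta_closed_closure.
  + by apply/disjoints_subset; rewrite setCK.
  + exact/subsetCPr.
- move=> separate F1 F2 cF1 cF2 F12.
  have [U1 [U2 [gU1 gU2 U12 FU1 FU2]]] := separate F1 F2 cF1 cF2 F12.
  have openE U : estar_theta_open (~` estar_theta_closure (~` U)).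
    by rewrite /estar_theta_open setCK; exact: estar_theta_closed_closure.
  have subU U : ~` estar_theta_closure (~` U) `<=` U.
    by apply/subsetCPl; exact: subset_estar_theta_closure.
  have supF F U : closed F -> gestar_theta_open U -> F `<=` U ->
      F `<=` ~` estar_theta_closure (~` U).
    move=> cF gU FU; apply/subsetCPr; apply: gU; first exact: closed_openC.
    exact: subsetC.
  exists (~` estar_theta_closure (~` U1)), (~` estar_theta_closure (~` U2)).
  split; [exact: openE..| |exact: supF|exact: supF].
  by apply: subsetI_eq0 U12; exact: subU.
Qed.
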